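(* Suppose that $f$ is a polynomial (with complex coefficients) of degree $7$ with $f(0)=0$ and $f'(0)=1$. Then there is a point $\zeta\in\mathbb{C}$ such that $f'(\zeta)=0$ and $|f(\zeta)/\zeta|\geq 1/7$. Moreover, if there is no point $\zeta\in\mathbb{C}$ such that $f'(\zeta)=0$ and $|f(\zeta)/\zeta|>1/7$, then $f$ is of the form $$ f(z)=\frac{1}{7a}\left(1-(1-az)^7\right) $$ for some $a\in\mathbb{C}\setminus\{0\}$.
   Context: Since $f'(0)=1\neq 0$, every zero $\zeta$ of $f'$ is nonzero, so $f(\zeta)/\zeta$ is well defined. *)

(* Defs.v *)
From mathcomp Require Import all_boot all_order all_algebra.
From mathcomp Require Import reals complex.

(* Main.v *)
Require Import Defs.
From mathcomp Require Import all_boot all_order all_algebra.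
From mathcomp Require Import reals complex.
From mathcomp Require Import ring.

Set Implicit Arguments.
Unset Strict Implicit.
Unset Printing Implicit Defensive.

Import Order.TTheory GRing.Theory Num.Theory.
Local Open Scope ring_scope.
Local Open Scope complex_scope.

(** Write f'(z) as the product of the 1 - z/r over the six critical points r,
    and let zeta be a critical point of least modulus.  Then
      f(zeta)/zeta = int_0^1 f'(t zeta) dt
                   = int_0^1 (1 - t) prod_j (1 - b_j t) dt,   b_j = zeta/r_j,
    where r_j runs over the five other critical points, so that every b_j lies
    in the closed unit disc.  The right-hand side is symmetric and affine in
    each b_j: it is the polar form of the one-variable polynomial
      Phi(x) = int_0^1 (1 - t) (1 - x t)^5 dt
    ([blossom_power_integral]).  By the Grace-Walsh-Szego coincidence theorem
    ([blossom_neq0]), proved here by iterating Laguerre's theorem on polar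
    derivatives ([root_polar]), every value that the polar form takes on the
    closed disc is also a value of Phi on the closed disc.  It is therefore
    enough to know that |Phi| >= 1/7 there.

    This bound is an explicit identity ([psi_norm_sqr]): for psi = 42 Phi,
    N = |1 - x|^2 and s = 1 - |x|^2, the difference |psi(x)|^2 - 36 equals
    7 N (N - 1)^2 (3 N^2 + 2 N + 1) plus s times a positive quantity.  It
    vanishes on the disc only at x = 1 and at the two points exp(+-i pi/3),
    which are on the unit circle.  The degree 7 is the borderline case in which
    these two extra points appear.

    For the equality case, let |f(zeta)/zeta| = 1/7.  The three extremal points
    give three different values of psi, and psi' does not vanish at any of
    them, so Phi takes the value f(zeta)/zeta at exactly one point b0 of the
    closed disc, simply.  The coincidence theorem is rigid in this situation
    ([blossom_eq0_simple]): all the b_j must equal b0.  Hence the five other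
    critical points coincide, and have the same modulus as zeta.  They are thus
    also of least modulus, and the same argument applied to one of them shows
    that zeta coincides with the remaining four; this excludes
    b0 = exp(+-i pi/3).  So f' is a sixth power of 1 - z/zeta. *)

(** * Polar derivatives and the coincidence theorem *)

Section Polar.
Variable C : numClosedFieldType.
Implicit Types (p q : {poly C}) (b c x w : C) (n : nat) (bs rs : seq C).

(** Laguerre's polar derivative with pole b, of a polynomial of formal degree
    n, normalized so that taking b = x in the value at x gives back p(x). *)
Definition polar n b p : {poly C} :=
  p + n%:R^-1 *: ((b%:P - 'X) * p^`()).

Lemma horner_polar n b p x :
  (polar n b p).[x] = p.[x] + n%:R^-1 * ((b - x) * p^`().[x]).
Proof. by rewrite /polar !hornerE. Qed.

Lemma coef_polar n b p k : (0 < n)%N ->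
  (polar n b p)`_k
  = n%:R^-1 * ((n%:R - k%:R) * p`_k + b * (k.+1%:R * p`_k.+1)).
Proof.
move=> n0; have n_neq0 : n%:R != 0 :> C by rewrite pnatr_eq0 -lt0n.
rewrite /polar coefD coefZ mulrBl coefB coefCM coefXM !coef_deriv.
by case: k => [|k] /=; field.
Qed.

Lemma size_polar n b p :
  (size p <= n.+2)%N -> (size (polar n.+1 b p) <= n.+1)%N.
Proof.
move=> sp; apply/leq_sizeP => k nk; rewrite coef_polar //.
rewrite [p`_k.+1](leq_sizeP _ _ sp) // !mulr0 addr0.
(* In degree n.+1 the factor n.+1 - k vanishes. *)
case: (ltngtP n.+1 k) nk => // [nk _|->]; last by rewrite subrr mul0r mulr0.
by rewrite [p`_k](leq_sizeP _ _ sp) // !mulr0.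
Qed.

(** The polar form of p, as a polynomial of formal degree [size bs]: the only
    symmetric function of the list bs that is affine in each entry and takes
    the value p(x) when all the entries are x. *)
Fixpoint blossom bs p : C :=
  if bs is b :: bs' then blossom bs' (polar (size bs) b p) else p.[0].

(** The inversion w = 1 / (x - b) carries the disc |b| <= 1 to the set where
    the function of w on the left is nonnegative, and the outside of the disc to
    the set where it is negative.  As this function is convex in w when
    |x| <= 1, the image of the outside is convex: this is the whole content of
    Laguerre's theorem. *)
Lemma inv_sub_disc x b : x != b ->
  let w := (x - b)^-1 in
  (1 - `|x| ^+ 2) * `|w| ^+ 2 + (x * w + (x * w)^*) - 1
  = (1 - `|b| ^+ 2) * `|w| ^+ 2.
Proof.
move=> xb; have d : x - b != 0 by rewrite subr_eq0.
have d' : x^* - b^* != 0 by rewrite -rmorphB conjC_eq0.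
rewrite /= !normCK !rmorphM !fmorphV rmorphB /=; field.
by apply/andP.
Qed.

(** An average of n points of the convex region described by
    [inv_sub_disc] (missing points are at w = 0, the image of infinity, which
    is strictly inside) cannot be the image of a point of the disc, unless
    every one of them is on the boundary and none is missing. *)
Lemma sum_inv_sub_disc n x b rs : (size rs <= n)%N ->
    `|x| <= 1 -> `|b| <= 1 -> x != b ->
    {in rs, forall r, x != r /\ 1 <= `|r|} ->
    \sum_(r <- rs) (x - r)^-1 = n%:R * (x - b)^-1 ->
  size rs = n /\ {in rs, forall r, `|r| = 1}.
Proof.
move=> srs x1 b1 xb rs1 sum_w.
set w := (x - b)^-1 in sum_w.
set A := 1 - `|x| ^+ 2.
have A0 : 0 <= A by rewrite subr_ge0 exprn_ile1.
pose F v := A * `|v| ^+ 2 + (x * v + (x * v)^*).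
have Fw : 1 <= F w.
  rewrite -subr_ge0 /F inv_sub_disc // mulr_ge0 ?exprn_ge0 //.
  by rewrite subr_ge0 exprn_ile1.
have Fr r : r \in rs -> F (x - r)^-1 <= 1.
  move=> /rs1[xr r1]; rewrite -subr_le0 /F inv_sub_disc //.
  by rewrite mulr_le0_ge0 ?exprn_ge0 // subr_le0 exprn_ege1.
pose l v := A * (w^* * v + w * v^*) + (x * v + (x * v)^*).
(* F is convex: it lies above its tangent at w. *)
have convF v : l v - A * `|w| ^+ 2 <= F v.
  rewrite -subr_ge0.
  have -> : F v - (l v - A * `|w| ^+ 2) = A * `|v - w| ^+ 2.
    by rewrite /F /l !normCK rmorphB; ring.
  by rewrite mulr_ge0 ?exprn_ge0.
have suml : \sum_(r <- rs) l (x - r)^-1 = n%:R * l w.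
  transitivity (l (\sum_(r <- rs) (x - r)^-1)).
    elim: (rs) => [|r s IH]; first by rewrite !big_nil /l rmorph0 !mulr0 rmorph0; ring.
    by rewrite !big_cons IH /l !rmorphM !rmorphD /=; ring.
  by rewrite sum_w /l !rmorphM /= conjC_nat; ring.
have le1 : n%:R <= \sum_(r <- rs) F (x - r)^-1.
  apply: (@le_trans _ _ (\sum_(r <- rs) (l (x - r)^-1 - A * `|w| ^+ 2))); last first.
    by apply: ler_sum.
  rewrite sumrB suml big_const_seq count_predT iter_addr_0.
  apply: (@le_trans _ _ (n%:R * F w)); first by rewrite ler_peMr.
  have -> : n%:R * l w - A * `|w| ^+ 2 *+ size rs
      = n%:R * F w + (A * `|w| ^+ 2) *+ (n - size rs).
    rewrite mulrnBr // /l /F !normCK; ring.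
  by rewrite lerDl mulrn_wge0 ?mulr_ge0 ?exprn_ge0.
have le2 : \sum_(r <- rs) F (x - r)^-1 <= (size rs)%:R.
  rewrite -sum1_size natr_sum big_seq [leRHS]big_seq.
  by apply: ler_sum => r /Fr.
have srs' : size rs = n.
  by apply/eqP; rewrite eqn_leq srs /= -(ler_nat C) (le_trans le1).
split=> // r r_rs; have [xr r1] := rs1 _ r_rs.
have : \sum_(r <- rs) (1 - F (x - r)^-1) <= 0.
  by rewrite sumrB subr_le0 (le_trans _ le1) // -srs' -sum1_size natr_sum.
have pos : forall r, r \in rs -> true -> 0 <= 1 - F (x - r)^-1.
  by move=> t /Fr Ft _; rewrite subr_ge0.
rewrite big_seq => sum0.
have /eqP: \sum_(i <- rs | i \in rs) (1 - F (x - i)^-1) = 0.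
  apply/eqP; rewrite eq_le sum0 sumr_ge0 // => i /pos; exact.
rewrite psumr_eq0; last by move=> i /pos; apply.
move/allP/(_ _ r_rs); rewrite r_rs /= -opprB oppr_eq0 /F inv_sub_disc //.
rewrite mulf_eq0 expf_eq0 /= normr_eq0 invr_eq0 [x - r == 0]subr_eq0 (negPf xr) orbF.
rewrite subr_eq0 eq_sym sqrf_eq1 => /orP[/eqP//|/eqP rN].
by have := normr_ge0 r; rewrite rN oppr_ge0 ler10.
Qed.

Lemma deriv_prod_XsubC rs x : {in rs, forall r, x != r} ->
  (\prod_(r <- rs) ('X - r%:P))^`().[x]
  = (\prod_(r <- rs) ('X - r%:P)).[x] * \sum_(r <- rs) (x - r)^-1.
Proof.
elim: rs => [|r rs IH] xrs; first by rewrite !big_nil derivC !hornerE.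
rewrite !big_cons derivM derivXsubC !hornerE.
rewrite IH => [|t trs]; last by rewrite xrs // inE trs orbT.
have xr : x - r != 0 by rewrite subr_eq0 xrs ?mem_head.
by field.
Qed.

(** Laguerre's theorem for the unit disc, with its equality case.  A zero x of
    the polar derivative satisfies n / (x - b) = p'(x) / p(x), which is the sum
    of the 1 / (x - r) over the zeros r of p. *)
Lemma root_polar n b x p : (size p <= n.+2)%N ->
    (forall r, root p r -> 1 <= `|r|) -> `|b| <= 1 -> `|x| <= 1 ->
    p.[x] != 0 -> (polar n.+1 b p).[x] = 0 ->
  size p = n.+2 /\ (forall r, root p r -> `|r| = 1).
Proof.
move=> sp rp b1 x1 px.
have p0 : p != 0 by apply: contraNneq px => ->; rewrite horner0.
have [rs def_p] := closed_field_poly_normal p.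
have rootE r : root p r = (r \in rs).
  by rewrite def_p rootZ ?lead_coef_eq0 // root_prod_XsubC.
have szE : size p = (size rs).+1.
  by rewrite def_p size_scale ?lead_coef_eq0 // size_prod_XsubC.
have xrs r : r \in rs -> x != r.
  by rewrite -rootE => pr; apply: contraNneq px => ->.
rewrite horner_polar => polar0.
have [xb|xb] := eqVneq x b.
  by move: polar0 px; rewrite xb subrr mul0r mulr0 addr0 => ->; rewrite eqxx.
have n0 : n.+1%:R != 0 :> C by rewrite pnatr_eq0.
have xb0 : x - b != 0 by rewrite subr_eq0.
have dp : p^`().[x] = p.[x] * \sum_(r <- rs) (x - r)^-1.
  by rewrite def_p derivZ !hornerZ deriv_prod_XsubC // mulrA.
have sum_w : \sum_(r <- rs) (x - r)^-1 = n.+1%:R * (x - b)^-1.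
  apply: (mulfI px); rewrite -dp.
  have -> : p^`().[x] = - ((x - b)^-1 * n.+1%:R
      * (n.+1%:R^-1 * ((b - x) * p^`().[x]))) by field; rewrite addrC natr1 n0.
  have /eqP := polar0; rewrite addr_eq0 => /eqP ->; ring.
have [||<- rs1] // := @sum_inv_sub_disc n.+1 x b rs _ x1 b1 xb _ sum_w.
- by rewrite -ltnS -szE.
- by move=> r rrs; rewrite xrs // rp ?rootE.
- by split=> // r; rewrite rootE => /rs1.
Qed.

Lemma polar_neq0 n b x p : (size p <= n.+2)%N ->
    (forall y, `|y| <= 1 -> p.[y] != 0) -> `|b| <= 1 -> `|x| <= 1 ->
  (polar n.+1 b p).[x] != 0.
Proof.
move=> sp p1 b1 x1; apply/eqP => polar0.
have rp r : root p r -> 1 < `|r|.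
  move=> pr; rewrite real_ltNge ?real1 ?normr_real //.
  by apply: contraTN pr => /p1.
have rp' r : root p r -> 1 <= `|r| by move/rp/ltW.
have [sp' rp1] := root_polar sp rp' b1 x1 (p1 _ x1) polar0.
have [|r pr] := closed_rootP p _; first by rewrite sp'.
by have := rp _ pr; rewrite rp1 ?ltxx.
Qed.

(** All the zeros of p being on the circle, hence all equal to b0 which is
    simple, p has degree one: this is the only way for the equality case of
    [root_polar] to occur. *)
Lemma polar_eq0_simple n b b0 x p : (size p <= n.+2)%N -> `|b0| = 1 ->
    p.[b0] = 0 -> p^`().[b0] != 0 ->
    (forall y, `|y| <= 1 -> p.[y] = 0 -> y = b0) ->
    `|b| <= 1 -> `|x| <= 1 -> x != b0 -> (polar n.+1 b p).[x] = 0 ->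
  n = 0 /\ b = b0.
Proof.
move=> sp b01 pb0 dpb0 p1 bd x1 xb0 polar0.
have px : p.[x] != 0 by apply: contraNneq xb0 => /p1 ->.
have rp r : root p r -> 1 <= `|r|.
  move=> /rootP pr; case: (real_leP (real1 _) (normr_real r)) => //.
  by move=> r1; have := p1 _ (ltW r1) pr => rb; rewrite rb b01 ltxx in r1.
have [sp' rp1] := root_polar sp rp bd x1 px polar0.
have p0 : p != 0 by rewrite -size_poly_eq0 sp'.
have [rs def_p] := closed_field_poly_normal p.
have rsb r : r \in rs -> r = b0.
  move=> rrs; have pr : root p r.
    by rewrite def_p rootZ ?lead_coef_eq0 // root_prod_XsubC.
  by apply: p1; [rewrite rp1|apply/rootP].
have srs : size rs = n.+1.
  by apply: succn_inj; rewrite -sp' def_p size_scale ?lead_coef_eq0 // size_prod_XsubC.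
case: rs def_p rsb srs => [|r [|r' t]] // def_p rsb [] // ; last first.
  have [rb r'b] : r = b0 /\ r' = b0 by split; apply: rsb; rewrite !inE eqxx ?orbT.
  move: dpb0; rewrite def_p !big_cons rb r'b.
  by rewrite derivZ !derivM !derivXsubC !hornerE subrr !(mul0r, mulr0, addr0) eqxx.
move=> n0; rewrite -n0 in polar0 *; split=> //; apply/eqP; rewrite -subr_eq0.
suff: lead_coef p * (b - b0) == 0 by rewrite mulf_eq0 lead_coef_eq0 (negPf p0).
rewrite -polar0 def_p big_seq1 (rsb r) ?mem_head // horner_polar lead_coefZ.
rewrite lead_coefXsubC derivZ derivXsubC !hornerZ hornerXsubC hornerC; apply/eqP.
by field.
Qed.

(** The coincidence theorem of Grace, Walsh and Szego for the unit disc: each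
    polar derivative keeps the zeros out of the disc, and after the last one
    only a constant is left. *)
Theorem blossom_neq0 bs p : (size p <= (size bs).+1)%N ->
    {in bs, forall b, `|b| <= 1} ->
    (forall y, `|y| <= 1 -> p.[y] != 0) ->
  blossom bs p != 0.
Proof.
elim: bs p => [|b bs IH] p /= sp bs1 p1; first by rewrite p1 // normr0.
apply: IH; first exact: size_polar.
- by move=> c cbs; rewrite bs1 // inE cbs orbT.
- by move=> y y1; rewrite polar_neq0 // bs1 ?mem_head.
Qed.

(** Rigidity of the coincidence theorem.  A pole b different from b0 removes
    the only zero in the disc, after which the value can no longer be 0; the
    pole b0 keeps b0 as the only zero in the disc, and keeps it simple. *)
Theorem blossom_eq0_simple bs p b0 : (size p <= (size bs).+1)%N ->
    {in bs, forall b, `|b| <= 1} -> `|b0| = 1 ->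
    p.[b0] = 0 -> p^`().[b0] != 0 ->
    (forall y, `|y| <= 1 -> p.[y] = 0 -> y = b0) ->
  blossom bs p = 0 -> {in bs, forall b, b = b0}.
Proof.
elim: bs p => [|b bs IH] p // sp bs1 b01 pb0 dpb0 p1 bl0.
have b1 : `|b| <= 1 by rewrite bs1 ?mem_head.
have bs1' : {in bs, forall c, `|c| <= 1}.
  by move=> c cbs; rewrite bs1 // inE cbs orbT.
have bb0 : b = b0.
  apply/eqP; apply: contraT => bb0; move/eqP: bl0; apply: contraLR => _ /=.
  apply: blossom_neq0 => //; first exact: size_polar.
  move=> x x1; apply/eqP => polar0.
  have [xb|xb] := eqVneq x b0; last first.
    have [_ bb0'] := polar_eq0_simple sp b01 pb0 dpb0 p1 b1 x1 xb polar0.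
    by rewrite bb0' eqxx in bb0.
  move/eqP: polar0; rewrite horner_polar xb pb0 add0r !mulf_eq0 invr_eq0.
  by rewrite pnatr_eq0 (negPf dpb0) subr_eq0 (negPf bb0).
move=> c; rewrite inE => /predU1P[-> //|cbs].
case: bs => [|b' bs'] // in IH sp bs1 bs1' bl0 cbs *.
apply: IH bl0 _ cbs => //; first exact: size_polar.
- by rewrite horner_polar pb0 bb0 subrr mul0r mulr0 addr0.
- have -> : (polar (size bs').+2 b p)^`().[b0]
      = (size bs').+1%:R / (size bs').+2%:R * p^`().[b0].
    rewrite /polar derivD derivZ derivM derivB derivC derivX bb0.
    rewrite !(hornerD, hornerN, hornerM, hornerZ, hornerC, hornerX).
    by field; rewrite -natrD pnatr_eq0.
  by rewrite mulf_neq0 // mulf_neq0 ?invr_eq0 ?pnatr_eq0.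
- move=> y y1 polar0; apply/eqP; apply: contraT => yb.
  by have [] := polar_eq0_simple sp b01 pb0 dpb0 p1 b1 y1 yb polar0.
Qed.

End Polar.

(** * Polar forms of integrals over the unit interval *)

Section Integral.
Variable C : numClosedFieldType.
Implicit Types (p q g : {poly C}) (b c x : C) (n k : nat) (bs : seq C).

Definition integral p : C := \sum_(k < size p) p`_k / k.+1%:R.

Lemma integral_widen n p :
  (size p <= n)%N -> integral p = \sum_(k < n) p`_k / k.+1%:R.
Proof.
move=> sp; rewrite /integral (big_ord_widen n (fun k => p`_k / k.+1%:R) sp).
rewrite big_mkcond; apply: eq_bigr => k _; case: ltnP => // pk.
by rewrite nth_default // mul0r.
Qed.

Lemma integralD p q : integral (p + q) = integral p + integral q.
Proof.
rewrite (integral_widen (size_polyD p q)) (integral_widen (leq_maxl _ (size q))).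
rewrite (integral_widen (leq_maxr (size p) _)) -big_split /=.
by apply: eq_bigr => k _; rewrite coefD mulrDl.
Qed.

Lemma integralZ c p : integral (c *: p) = c * integral p.
Proof.
rewrite (integral_widen (size_scale_leq c p)) mulr_sumr.
by apply: eq_bigr => k _; rewrite coefZ mulrA.
Qed.

Lemma integralXn k : integral 'X^k = k.+1%:R^-1.
Proof.
rewrite /integral size_polyXn big_ord_recr /= coefXn eqxx mul1r big1 ?add0r //.
by move=> i _; rewrite coefXn ltn_eqF ?mul0r.
Qed.

Lemma polarBC n b c p : polar n b (p - c%:P) = polar n b p - c%:P.
Proof. by rewrite /polar derivB derivC subr0 addrAC. Qed.

Lemma blossomBC bs c p : blossom bs (p - c%:P) = blossom bs p - c.
Proof.
by elim: bs p => [|b bs IH] p /=; rewrite ?polarBC ?IH // hornerD hornerN hornerC.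
Qed.

(** The polynomial in x that equals int_0^1 g(t) (1 - x t)^n dt, expanded by
    the binomial formula. *)
Definition power_integral n g : {poly C} :=
  \poly_(k < n.+1) ((-1) ^+ k * 'C(n, k)%:R * integral ('X^k * g : {poly C})).

Lemma coef_power_integral n g k :
  (power_integral n g)`_k = (-1) ^+ k * 'C(n, k)%:R * integral ('X^k * g).
Proof.
by rewrite coef_poly ltnS; case: leqP => // nk; rewrite bin_small // mulr0 mul0r.
Qed.

(** Taking a polar derivative replaces one of the factors 1 - x t under the
    integral sign by 1 - b t. *)
Lemma polar_power_integral n b g :
  polar n.+1 b (power_integral n.+1 g) = power_integral n ((1 - b *: 'X) * g).
Proof.
apply/polyP => k; rewrite coef_polar // !coef_power_integral.
have -> : 'X^k * ((1 - b *: 'X) * g) = 'X^k * g + (- b) *: ('X^(k.+1) * g).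
  by rewrite exprSr scaleNr -!mul_polyC; ring.
rewrite integralD integralZ.
have n0 : n.+1%:R != 0 :> C by rewrite pnatr_eq0.
have E1 : k.+1%:R * 'C(n.+1, k.+1)%:R = n.+1%:R * 'C(n, k)%:R :> C.
  by rewrite -!natrM -mul_bin_diag.
have E2 : (n.+1%:R - k%:R) * 'C(n.+1, k)%:R = n.+1%:R * 'C(n, k)%:R :> C.
  have [kn|nk] := leqP k n.+1; first by rewrite -natrB // -!natrM -mul_bin_down.
  by rewrite !bin_small ?mulr0 // ltnW.
apply: (mulfI n0); rewrite mulrA divff // mul1r exprS.
transitivity ((-1) ^+ k * ((n.+1%:R - k%:R) * 'C(n.+1, k)%:R) * integral ('X^k * g)
  - b * (-1) ^+ k * (k.+1%:R * 'C(n.+1, k.+1)%:R) * integral ('X^(k.+1) * g)).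
  by rewrite -mulN1r; ring.
by rewrite E1 E2; ring.
Qed.

Lemma blossom_power_integral bs g :
  blossom bs (power_integral (size bs) g)
  = integral (\prod_(b <- bs) (1 - b *: 'X) * g).
Proof.
elim: bs g => [|b bs IH] g /=.
  by rewrite horner_coef0 coef_power_integral big_nil !mul1r.
by rewrite polar_power_integral IH big_cons mulrA [_ * (1 - _)]mulrC.
Qed.

End Integral.

(** * The lower bound on the diagonal *)

Section Degree5.
Variable C : numClosedFieldType.
Implicit Types (x c : C).

(** 42 times int_0^1 (1 - t) (1 - x t)^5 dt; see [power_integral5E]. *)
Definition psi x : C :=
  21%:R - 35%:R * x + 35%:R * x ^+ 2 - 21%:R * x ^+ 3 + 7%:R * x ^+ 4 - x ^+ 5.

(** A sum of squares and of monomials with positive coefficients, obtained by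
    expanding |psi(x)|^2 - 36 in powers of s = 1 - |x|^2 with coefficients in
    N = |1 - x|^2, and completing squares in the coefficient of s. *)
Definition interior_excess N s : C :=
  (7%:R * N ^+ 2 - 3%:R) ^+ 2 + 21%:R * N ^+ 2 * (N - 1) ^+ 2
  + 21%:R * N ^+ 2 + 14%:R * N + 21%:R
  + s * (24%:R + 21%:R * N + 105%:R * N ^+ 3)
  + s ^+ 2 * (18%:R + 28%:R * N + 84%:R * N ^+ 2)
  + s ^+ 3 * (12%:R + 35%:R * N) + 6%:R * s ^+ 4.

Ltac nonneg := repeat first [assumption | apply: ler0n | apply: exprn_ge0
  | apply: mulr_ge0 | apply: addr_ge0].

Lemma interior_excess_gt0 N s : 0 <= N -> 0 <= s -> 0 < interior_excess N s.
Proof.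
move=> N0 s0; have Nr : N \is Num.real by rewrite ger0_real.
have sqr_ge0 y : y \is Num.real -> 0 <= y ^+ 2.
  by move=> yr; rewrite real_exprn_even_ge0.
have Nr1 : 0 <= (N - 1) ^+ 2 by rewrite sqr_ge0 // realB ?real1.
have Nr3 : 0 <= (7%:R * N ^+ 2 - 3%:R) ^+ 2.
  by rewrite sqr_ge0 // realB ?realM ?realX ?realn.
rewrite /interior_excess; do 4![apply: ltr_wpDr; first by nonneg].
apply: ltr_wpDl; last by rewrite ltr0n.
by nonneg.
Qed.

(** On the unit circle s = 0, and the double factor (N - 1)^2 expresses that
    |psi| has its minimum 6 also at the points exp(+-i pi/3), where N = 1. *)
Lemma psi_norm_sqr x :
  let N := `|1 - x| ^+ 2 in
  let s := 1 - `|x| ^+ 2 in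
  `|psi x| ^+ 2 - 36%:R
  = 7%:R * (N * (N - 1) ^+ 2 * (3%:R * N ^+ 2 + 2%:R * N + 1)) + s * interior_excess N s.
Proof.
rewrite /= /psi /interior_excess !normCK.
rewrite !(rmorphD, rmorphN, rmorphM, rmorphXn, rmorph1, conjC_nat) /=.
ring.
Qed.

Lemma psi_bound x : `|x| <= 1 ->
  6%:R <= `|psi x| /\
  (`|psi x| = 6%:R -> `|x| = 1 /\ (x - 1) * (x ^+ 2 - x + 1) = 0).
Proof.
move=> x1; have := psi_norm_sqr x; rewrite /=.
set N := `|1 - x| ^+ 2; set s := 1 - `|x| ^+ 2.
have N0 : 0 <= N by rewrite exprn_ge0.
have s0 : 0 <= s by rewrite subr_ge0 exprn_ile1.
have Nr1 : 0 <= (N - 1) ^+ 2.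
  by rewrite real_exprn_even_ge0 // realB ?real1 ?ger0_real.
set Q := 3%:R * N ^+ 2 + 2%:R * N + 1.
have Q0 : 0 < Q by rewrite ltr_wpDl ?ltr01 // addr_ge0 ?mulr_ge0 ?exprn_ge0 ?ler0n.
move=> eqpsi; have K0 := interior_excess_gt0 N0 s0.
have T0 : 0 <= 7%:R * (N * (N - 1) ^+ 2 * Q).
  by move: (ltW Q0) => {}Q0; clearbody Q; nonneg.
have sK : 0 <= s * interior_excess N s by rewrite mulr_ge0 // ltW.
split.
  rewrite -(@ler_pXn2r _ 2) ?nnegrE ?ler0n //.
  have -> : 6%:R ^+ 2 = 36%:R :> C by ring.
  by rewrite -subr_ge0 eqpsi addr_ge0.
move=> eq6; move/eqP: eqpsi.
have -> : `|psi x| ^+ 2 - 36%:R = 0 by rewrite eq6; ring.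
rewrite eq_sym paddr_eq0 // => /andP[].
rewrite mulf_eq0 pnatr_eq0 /= mulf_eq0 (gt_eqF Q0) orbF mulf_eq0 => eqN.
rewrite mulf_eq0 (gt_eqF K0) orbF subr_eq0 eq_sym sqrf_eq1.
case/orP=> /eqP nx; last first.
  by have := normr_ge0 x; rewrite nx oppr_ge0 ler10.
split=> //; case/orP: eqN.
  by rewrite /N expf_eq0 normr_eq0 subr_eq0 /= => /eqP <-; rewrite subrr mul0r.
rewrite expf_eq0 /= subr_eq0 => /eqP eqN1.
have xx : x * x^* = 1 by rewrite -normCK nx expr1n.
have sx : x + x^* = 1.
  have : (1 - x) * (1 - x)^* = 1 by rewrite -normCK.
  rewrite rmorphB rmorph1 => E.
  transitivity (1 + x * x^* - (1 - x) * (1 - x^*)); first by ring.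
  by rewrite E xx addrK.
have -> : x ^+ 2 - x + 1 = x * (x + x^* - 1) + (1 - x * x^*) by ring.
by rewrite sx xx !subrr mulr0 addr0 mulr0.
Qed.

(** The values are 6 at x = 1 and 6 (1 - x) at the zeros of x^2 - x + 1. *)
Lemma psi_inj_extremal x y :
  `|x| <= 1 -> `|y| <= 1 -> `|psi x| = 6%:R -> psi x = psi y -> x = y.
Proof.
move=> x1 y1 px pxy; have py : `|psi y| = 6%:R by rewrite -pxy.
have [_ /(_ px)[_ ex]] := psi_bound x1; have [_ /(_ py)[_ ey]] := psi_bound y1.
(* The cubic is the quotient of psi(z) - 6 (1 - z) by z^2 - z + 1. *)
have root6 z : z ^+ 2 - z + 1 = 0 -> psi z = 6%:R * (1 - z).
  move=> ez; transitivity (6%:R * (1 - z) + (z ^+ 2 - z + 1) *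
     (- z ^+ 3 + 6%:R * z ^+ 2 - 14%:R * z + 15%:R)); first by rewrite /psi; ring.
  by rewrite ez mul0r addr0.
have psi1 : psi 1 = 6%:R by rewrite /psi; ring.
have n1 z : z ^+ 2 - z + 1 = 0 -> psi z <> psi 1.
  move=> ez; rewrite root6 // psi1 => /eqP; rewrite -subr_eq0.
  have -> : 6%:R * (1 - z) - 6%:R = - 6%:R * z by ring.
  rewrite mulf_eq0 oppr_eq0 pnatr_eq0 /= => /eqP z0.
  by move/eqP: ez; rewrite z0 expr0n /= subrr add0r oner_eq0.
move/eqP: ex; rewrite mulf_eq0 subr_eq0 => /orP[]/eqP ex;
move/eqP: ey; rewrite mulf_eq0 subr_eq0 => /orP[]/eqP ey.
- by rewrite ex ey.
- by case: (n1 _ ey); rewrite -pxy ex.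
- by case: (n1 _ ex); rewrite pxy ey.
- have := pxy; rewrite !root6 // => /mulfI H.
  by apply: oppr_inj; apply: (addrI 1); apply: H; rewrite pnatr_eq0.
Qed.

Definition dpsi x : C :=
  - 35%:R + 70%:R * x - 63%:R * x ^+ 2 + 28%:R * x ^+ 3 - 5%:R * x ^+ 4.

Lemma dpsi_neq0 x : `|x| <= 1 -> `|psi x| = 6%:R -> dpsi x != 0.
Proof.
move=> x1 px; have [_ /(_ px)[nx /eqP]] := psi_bound x1.
rewrite mulf_eq0 subr_eq0 => /orP[]/eqP ex.
  have -> : dpsi x = - 5%:R by rewrite /dpsi ex; ring.
  by rewrite oppr_eq0 pnatr_eq0.
have -> : dpsi x = 12%:R * x + (x ^+ 2 - x + 1) * (- 5%:R * x ^+ 2 + 23%:R * x - 35%:R).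
  by rewrite /dpsi; ring.
rewrite ex mul0r addr0 mulf_neq0 ?pnatr_eq0 //.
by rewrite -normr_eq0 nx oner_eq0.
Qed.

Lemma power_integral5E : power_integral 5 (1 - 'X) = 42%:R^-1 *:
  (21%:R%:P - 35%:R *: 'X + 35%:R *: 'X^2 - 21%:R *: 'X^3 + 7%:R *: 'X^4 - 'X^5)
  :> {poly C}.
Proof.
have I k : integral ('X^k * (1 - 'X) : {poly C}) = k.+1%:R^-1 - k.+2%:R^-1.
  by rewrite mulrBr mulr1 -exprSr -scaleN1r integralD integralZ !integralXn mulN1r.
rewrite /power_integral poly_def !big_ord_recl big_ord0 /=.
rewrite !I /bump /= !add1n.
apply/polyP => k.
rewrite !(coefD, coefN, coefZ, coefC, coefX, coefXn).
by case: k => [|[|[|[|[|[|k]]]]]] /=; rewrite ?nth_nil ?binE /=; field.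
Qed.

End Degree5.

(** * Critical points of polynomials of degree seven *)

Section DualMeanValue.
Variable C : numClosedFieldType.
Implicit Types (f p : {poly C}) (b c x zeta : C) (bs rs : seq C).

Lemma horner_power_integral5 x :
  (power_integral 5 (1 - 'X)).[x] = psi x / 42%:R.
Proof.
rewrite power_integral5E.
rewrite !(hornerD, hornerN, hornerZ, hornerC, hornerX, hornerXn) /psi.
by field.
Qed.

Lemma deriv_power_integral5 x :
  (power_integral 5 (1 - 'X))^`().[x] = dpsi x / 42%:R.
Proof.
rewrite power_integral5E !(derivD, derivN, derivZ, derivC, derivX, derivXn).
rewrite !(hornerD, hornerN, hornerZ, hornerC, hornerX, hornerXn, hornerMn) /dpsi /=.
by field.
Qed.

(** The estimate of psi transferred from the diagonal to all of the polydisc by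
    the coincidence theorem, applied to the polynomial psi / 42 - c. *)
Lemma integral_bound bs : size bs = 5%N -> {in bs, forall b, `|b| <= 1} ->
  let c := integral (\prod_(b <- bs) (1 - b *: 'X) * (1 - 'X)) in
  7%:R^-1 <= `|c| /\
  (`|c| = 7%:R^-1 -> exists2 b0, `|b0| = 1 & {in bs, forall b, b = b0}).
Proof.
move=> sbs bs1 c.
pose P := power_integral 5 (1 - 'X : {poly C}) - c%:P.
have blP : blossom bs P = 0.
  by rewrite blossomBC -sbs blossom_power_integral subrr.
have sP : (size P <= (size bs).+1)%N.
  rewrite sbs (leq_trans (size_polyD _ _)) // geq_max size_poly size_polyN.
  by rewrite (leq_trans (size_polyC_leq1 _)).
have PE x : (P.[x] == 0) = (psi x == 42%:R * c).
  have n42 : 42%:R != 0 :> C by rewrite pnatr_eq0.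
  rewrite hornerD hornerN hornerC horner_power_integral5 subr_eq0.
  by rewrite -(inj_eq (mulfI n42)) mulrC divfK.
have normc x : psi x = 42%:R * c -> `|psi x| = 42%:R * `|c|.
  by move=> ->; rewrite normrM normr_nat.
have e42 : 42%:R * 7%:R^-1 = 6%:R :> C by field.
have lb : 7%:R^-1 <= `|c|.
  rewrite real_leNgt ?normr_real ?realV ?realn //; apply/negP => c7.
  suff : blossom bs P != 0 by rewrite blP eqxx.
  apply: blossom_neq0 => // y y1.
  rewrite PE; apply/eqP => /normc ny.
  have [] := psi_bound y1; rewrite ny -e42 ler_pM2l ?ltr0n // => le7 _.
  by have := lt_le_trans c7 le7; rewrite ltxx.
split=> // c7.
have norm6 x : psi x = 42%:R * c -> `|psi x| = 6%:R.
  by move=> /normc ->; rewrite c7.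
(* The derivative of P at 0 does not vanish. *)
have P0 : P != 0.
  apply/eqP => P0; have := deriv_power_integral5 0.
  rewrite -[_^`()]subr0 -(derivC c) -derivB -/P P0 deriv0 horner0 => /eqP.
  have -> : dpsi 0 = - 35%:R :> C by rewrite /dpsi; ring.
  by rewrite eq_sym mulf_eq0 oppr_eq0 invr_eq0 !pnatr_eq0.
have [rs def_P] := closed_field_poly_normal P.
have rootE r : (r \in rs) = (psi r == 42%:R * c).
  by rewrite -PE -rootE def_P rootZ ?lead_coef_eq0 // root_prod_XsubC.
have [/hasP[b0 b0rs b01]|] := boolP (has (fun r => `|r| <= 1) rs); last first.
  move/hasPn => no_root; suff : blossom bs P != 0 by rewrite blP eqxx.
  apply: blossom_neq0 => // y y1; rewrite PE -rootE.
  by apply: contraL y1 => /no_root.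
have b0c : psi b0 = 42%:R * c by apply/eqP; rewrite -rootE.
have nb0 : `|b0| = 1 by have [_ /(_ (norm6 _ b0c))[]] := psi_bound b01.
exists b0 => //; apply: blossom_eq0_simple blP => //.
- by apply/eqP; rewrite PE b0c.
- rewrite derivB derivC subr0 deriv_power_integral5 mulf_neq0 ?invr_eq0 ?pnatr_eq0 //.
  by rewrite dpsi_neq0 // norm6.
- move=> y y1 /eqP; rewrite PE => /eqP yc.
  by apply: psi_inj_extremal => //; rewrite ?norm6 // yc.
Qed.

(** f(zeta) / zeta is the integral of f'(t zeta) over t in [0, 1]. *)
Lemma ratioE f zeta : f.[0] = 0 -> zeta != 0 ->
  f.[zeta] / zeta = integral (f^`() \Po (zeta *: 'X)).
Proof.
move=> f0 z0; have [->|fn0] := eqVneq f 0.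
  by rewrite horner0 mul0r deriv0 comp_poly0 /integral size_poly0 big_ord0.
have sf : (size f^`() <= (size f).-1)%N by rewrite -ltnS prednK ?size_poly_gt0 ?lt_size_deriv.
have coefE k : (f^`() \Po (zeta *: 'X))`_k = zeta ^+ k * f^`()`_k.
  rewrite coef_comp_poly; have [kf|fk] := ltnP k (size f^`()).
    rewrite (bigD1 (Ordinal kf)) //= exprZn coefZ coefXn eqxx mulr1 mulrC.
    rewrite big1 ?addr0 // => i ik; rewrite exprZn coefZ coefXn eq_sym.
    by rewrite (negPf (ik : (i : nat) != k)) !mulr0.
  rewrite [f^`()`_k]nth_default // mulr0 big1 // => i _.
  by rewrite exprZn coefZ coefXn gtn_eqF ?mulr0 // (leq_trans _ fk).
have sc : (size (f^`() \Po (zeta *: 'X)) <= (size f).-1)%N.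
  by apply/leq_sizeP => j sj; rewrite coefE (leq_sizeP _ _ sf) ?mulr0.
rewrite (integral_widen sc) horner_coef.
have -> : size f = (size f).-1.+1 by rewrite prednK ?size_poly_gt0.
rewrite big_ord_recl /= -horner_coef0 f0 mul0r add0r mulr_suml.
apply: eq_bigr => k _; rewrite coefE coef_deriv /bump /= add1n exprS -mulr_natr.
by field; rewrite z0 addrC natr1 pnatr_eq0.
Qed.

Lemma exists_min_norm rs : rs != [::] ->
  exists2 zeta, zeta \in rs & {in rs, forall r, `|zeta| <= `|r|}.
Proof.
elim: rs => [|r rs IH] // _; have [->|/IH[z zrs zmin]] := eqVneq rs [::].
  by exists r; rewrite ?mem_head // => t; rewrite inE => /eqP ->.
have [rz|zr] := real_leP (normr_real r) (normr_real z).
  exists r; rewrite ?mem_head // => t; rewrite inE => /predU1P[->//|/zmin].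
  exact: le_trans.
exists z; first by rewrite inE zrs orbT.
by move=> t; rewrite inE => /predU1P[->|/zmin//]; exact: ltW.
Qed.

Lemma deriv_factorization f : size f = 8%N -> f^`().[0] = 1 ->
  exists rs, [/\ size rs = 6%N, {in rs, forall r, r != 0},
    {in rs, forall r, f^`().[r] = 0} &
    f^`() = \prod_(r <- rs) (1 - r^-1 *: 'X)].
Proof.
move=> sf df0; have [rs def_f'] := closed_field_poly_normal f^`().
have sf' : size f^`() = 7%N.
  apply/eqP; rewrite eqn_leq; apply/andP; split.
    by rewrite -ltnS -sf lt_size_deriv // -size_poly_gt0 sf.
  rewrite ltnNge; apply/negP => /leq_sizeP/(_ 6%N (leqnn _)) /eqP.
  rewrite coef_deriv mulrn_eq0 /=.
  have -> : f`_7 = lead_coef f by rewrite /lead_coef sf.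
  by rewrite lead_coef_eq0 -size_poly_eq0 sf.
have f'0 : f^`() != 0 by rewrite -size_poly_eq0 sf'.
have l0 : lead_coef f^`() != 0 by rewrite lead_coef_eq0.
have rootE r : (r \in rs) = root f^`() r.
  by rewrite def_f' rootZ // root_prod_XsubC.
have rs0 r : r \in rs -> r != 0.
  rewrite rootE; apply: contraTneq => ->; rewrite /root df0.
  exact: oner_neq0.
exists rs; split=> //.
- by apply: succn_inj; rewrite -sf' [in RHS]def_f' size_scale // size_prod_XsubC.
- by move=> r; rewrite rootE => /rootP.
have prodE : \prod_(r <- rs) ('X - r%:P)
    = (\prod_(r <- rs) (- r)) *: \prod_(r <- rs) (1 - r^-1 *: 'X).
  elim: (rs) rs0 => [|r s IH] s0; first by rewrite !big_nil scale1r.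
  rewrite !big_cons IH; last by move=> t ts; rewrite s0 // inE ts orbT.
  rewrite [- r * _]mulrC -scalerA -scalerAr; congr (_ *: _).
  rewrite scalerAl; congr (_ * _).
  by rewrite scalerBr scalerA mulNr divff ?s0 ?mem_head // scaleN1r opprK
             scaleNr alg_polyC addrC.
set Q := \prod_(r <- rs) (1 - r^-1 *: 'X) in prodE *.
have f'E : f^`() = (lead_coef f^`() * \prod_(r <- rs) - r) *: Q.
  by rewrite -scalerA -prodE.
have Q0 : Q.[0] = 1 by rewrite horner_prod big1 // => r _; rewrite !hornerE; ring.
suff c1 : lead_coef f^`() * \prod_(r <- rs) - r = 1 by rewrite f'E c1 scale1r.
by have := df0; rewrite {1}f'E hornerZ Q0 mulr1.
Qed.

(** Choosing zeta of least modulus is what puts all the ratios zeta / r in the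
    closed unit disc. *)
Lemma ratio_min_root f zeta rs : f.[0] = 0 -> size rs = 6%N ->
    {in rs, forall r, r != 0} -> f^`() = \prod_(r <- rs) (1 - r^-1 *: 'X) ->
    zeta \in rs -> {in rs, forall r, `|zeta| <= `|r|} ->
  7%:R^-1 <= `|f.[zeta] / zeta| /\
  (`|f.[zeta] / zeta| = 7%:R^-1 ->
     exists2 r0, `|r0| = `|zeta| & {in rem zeta rs, forall r, r = r0}).
Proof.
move=> f0 srs rs0 def_f' zrs zmin; have z0 := rs0 _ zrs.
have rem_rs r : r \in rem zeta rs -> r \in rs by apply: mem_rem.
rewrite ratioE //; set bs := [seq zeta / r | r <- rem zeta rs].
have -> : f^`() \Po (zeta *: 'X) = \prod_(b <- bs) (1 - b *: 'X) * (1 - 'X).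
  rewrite def_f' (perm_big _ (perm_to_rem zrs)) big_cons mulrC comp_polyM rmorph_prod /=.
  have compE c : (1 - c *: 'X) \Po (zeta *: 'X) = 1 - (zeta * c) *: 'X.
    by rewrite comp_polyB comp_polyZ comp_polyX scalerA mulrC comp_polyC.
  rewrite big_map compE divff // scale1r; congr (_ * _).
  by apply: eq_bigr => r _; rewrite compE.
have sbs : size bs = 5%N by rewrite size_map size_rem // srs.
have bs1 : {in bs, forall b, `|b| <= 1}.
  move=> _ /mapP[r /rem_rs rrs ->]; rewrite normrM normfV ler_pdivrMr ?mul1r ?zmin //.
  by rewrite normr_gt0 rs0.
have [lb eq_case] := integral_bound sbs bs1; split=> // /eq_case[b0 nb0 bsb0].
have b0n0 : b0 != 0 by rewrite -normr_eq0 nb0 oner_eq0.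
exists (zeta / b0); first by rewrite normrM normfV nb0 invr1 mulr1.
move=> r rrem; rewrite -(bsb0 (zeta / r)); last by apply: map_f.
by rewrite invf_div mulrCA divff ?mulr1.
Qed.

Lemma deriv_inj0 f g : f^`() = g^`() -> f.[0] = g.[0] -> f = g.
Proof.
move=> dfg fg0; apply/polyP => -[|k]; first by rewrite -!horner_coef0.
have /(congr1 (fun p : {poly C} => p`_k)) := dfg; rewrite !coef_deriv.
by move/eqP; rewrite eqr_pMn2r // => /eqP.
Qed.

Theorem dual_mean_value7 f :
    size f = 8%N -> f.[0] = 0 -> f^`().[0] = 1 ->
  (exists zeta, f^`().[zeta] = 0 /\ 7%:R^-1 <= `|f.[zeta] / zeta|) /\
  (~ (exists zeta, f^`().[zeta] = 0 /\ 7%:R^-1 < `|f.[zeta] / zeta|) ->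
   exists2 a, a != 0 & forall z,
     f.[z] = 1 / (7%:R * a) * (1 - (1 - a * z) ^+ 7)).
Proof.
move=> sf f0 df0; have [rs [srs rs0 rsf' def_f']] := deriv_factorization sf df0.
have [zeta zrs zmin] : exists2 zeta, zeta \in rs & {in rs, forall r, `|zeta| <= `|r|}.
  by apply: exists_min_norm; rewrite -size_eq0 srs.
have ratio z := @ratio_min_root f z rs f0 srs rs0 def_f'.
split=> [|no_gt]; first by exists zeta; split; [exact: rsf'|case: (ratio _ zrs zmin)].
have extremal z : z \in rs -> {in rs, forall r, `|z| <= `|r|} ->
    exists2 r0, `|r0| = `|z| & {in rem z rs, forall r, r = r0}.
  move=> zr zm; have [lb] := ratio _ zr zm; apply.
  apply/eqP; rewrite eq_le lb andbT real_leNgt ?realV ?realn ?normr_real //.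
  by apply/negP => gt7; apply: no_gt; exists z; split=> //; exact: rsf'.
have [r0 nr0 rem_r0] := extremal _ zrs zmin.
have perm_rs := perm_to_rem zrs.
have srem : size (rem zeta rs) = 5%N by rewrite size_rem // srs.
case rem_def : (rem zeta rs) (srem) => [|t1 [|t2 t]] // _.
(* Five critical points are at r0, of least modulus too; what remains when one
   of them is removed contains both zeta and r0, and is constant. *)
have rz : r0 = zeta.
  apply/eqP; apply: contraT => rz.
  have [t1E t2E] : t1 = r0 /\ t2 = r0.
    by split; apply: rem_r0; rewrite rem_def !inE eqxx ?orbT.
  have r0rs : r0 \in rs by rewrite (perm_mem perm_rs) rem_def t1E !inE eqxx orbT.
  have r0min : {in rs, forall r, `|r0| <= `|r|} by rewrite nr0.
  have [r1 _ rem_r1] := extremal _ r0rs r0min.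
  have perm0 : perm_eq (rem r0 rs) [:: zeta, r0 & t].
    rewrite -(perm_cons r0) -(permPl (perm_to_rem r0rs)) (permPl perm_rs).
    rewrite rem_def t1E t2E.
    by rewrite (perm_catCA [:: zeta] [:: r0]).
  have r0r1 : r0 = r1 by apply: rem_r1; rewrite (perm_mem perm0) !inE eqxx orbT.
  have zr1 : zeta = r1 by apply: rem_r1; rewrite (perm_mem perm0) mem_head.
  by rewrite r0r1 zr1 eqxx in rz.
have rsz r : r \in rs -> r = zeta.
  by rewrite (perm_mem perm_rs) inE => /predU1P[//|/rem_r0 ->].
have z0 := rs0 _ zrs; have a0 : zeta^-1 != 0 by rewrite invr_eq0.
exists zeta^-1 => // z.
pose g : {poly C} := (7%:R * zeta^-1)^-1 *: (1 - (1 - zeta^-1 *: 'X) ^+ 7).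
suff -> : f = g.
  by rewrite /g !hornerE.
apply: deriv_inj0; last by rewrite f0 /g !hornerE; ring.
have -> : f^`() = (1 - zeta^-1 *: 'X) ^+ 6.
  have rs_nseq : rs = nseq 6 zeta.
    by rewrite -srs; apply/all_pred1P/allP => r /rsz /= ->.
  by rewrite def_f' rs_nseq /= !big_cons big_nil !exprS expr0.
rewrite /g derivZ derivB deriv_exp /= derivB !derivZ derivC derivX.
rewrite !sub0r mulNr mulNrn opprK -scalerAl mul1r -scaler_nat !scalerA.
by rewrite -mulrA mulVf ?scale1r // mulf_neq0 ?pnatr_eq0.
Qed.

End DualMeanValue.
Theorem theorem1 (R : realType) (f : {poly R[i]})
    (degf : size f = 8%N) (f0 : f.[0] = 0) (df0 : f^`().[0] = 1) :
  (exists zeta : R[i], f^`().[zeta] = 0 /\ 1 / 7%:R <= `|f.[zeta] / zeta|) /\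
  (~ (exists zeta : R[i], f^`().[zeta] = 0 /\ 1 / 7%:R < `|f.[zeta] / zeta|) ->
   exists a : R[i], a != 0 /\
     forall z : R[i], f.[z] = 1 / (7%:R * a) * (1 - (1 - a * z) ^+ 7)).
Proof.
rewrite !div1r; have [ex7 eq7] := dual_mean_value7 degf f0 df0.
by split=> // /eq7[a a0 fE]; exists a.
Qed.
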